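(* Let $n\ge 1$, let $a,b\in\mathbb{R}^n$, let $Q\in\mathbb{R}^{n\times n}$ be a symmetric positive semidefinite matrix, and let $\mathcal{X}\subseteq\mathbb{R}^n\times\mathbb{R}^n$ be a closed convex set. Consider the following two optimization problems. (OptPersp): over $x\in\mathbb{R}^n$, $y\in\mathbb{R}^n$ and symmetric $Y\in\mathbb{R}^{n\times n}$, $$\min\; a'x+b'y+\langle Q,Y\rangle\quad\text{s.t.}\quad Y-yy'\succeq 0,\quad y_i^2\le Y_{ii}x_i\ \ (i=1,\dots,n),\quad 0\le x\le 1,\quad y\ge 0,\quad (x,y)\in\mathcal{X}.$$ (Shor): over $x\in\mathbb{R}^n$, $y\in\mathbb{R}^n$ and symmetric $Z\in\mathbb{R}^{2n\times 2n}$, $$\min\; a'x+b'y+\sum_{i=1}^n\sum_{j=1}^n Q_{ij}Z_{ij}\quad\text{s.t.}\quad Z_{i,i+n}=y_i,\ \ Z_{i+n,i+n}=x_i\ \ (i=1,\dots,n),$$ $$Z-\begin{pmatrix} y \\ x \end{pmatrix}\begin{pmatrix} y' & x' \end{pmatrix}\succeq 0,\quad 0\le x\le 1,\quad y\ge 0,\quad (x,y)\in\mathcal{X}.$$ Then (OptPersp) and (Shor) are equivalent: for every feasible solution of (Shor) there is a feasible solution of (OptPersp) with the same objective value, and for every feasible solution of (OptPersp) there is a feasible solution of (Shor) with the same objective value. In particular, the two problems have the same optimal value (infimum in $[-\infty,+\infty]$).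
   Context: A prime denotes transpose; $\langle A,B\rangle=\sum_{i,j}A_{ij}B_{ij}$ is the trace inner product; $M\succeq 0$ means that the symmetric matrix $M$ is positive semidefinite; vector inequalities such as $0\le x\le 1$ and $y\ge 0$ are componentwise. Both problems are convex relaxations of the mixed-integer quadratic problem with indicator variables: minimize $a'x+b'y+y'Qy$ subject to $y_i(1-x_i)=0$ for $i=1,\dots,n$, $x\in\{0,1\}^n$, $y\in\mathbb{R}^n_+$, $(x,y)\in\mathcal{X}$. *)

(* Defs.v *)
From mathcomp Require Export all_boot all_order all_algebra.
From mathcomp Require Export sesquilinear.
From mathcomp Require Export boolp classical_sets reals ereal topology.
From mathcomp Require Export normedtype convex.
Export Order.TTheory GRing.Theory Num.Theory.
Export numFieldNormedType.Exports.

Set Implicit Arguments.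
Unset Strict Implicit.
Unset Printing Implicit Defensive.

Local Open Scope classical_set_scope.
Local Open Scope ring_scope.

Definition psd (R : realType) (m : nat) (M : 'M[R]_m) : Prop :=
  M \is symmetricmx /\ forall v : 'cV[R]_m, 0 <= (v^T *m M *m v) 0 0.

Definition dotcv (R : realType) (n : nat) (u v : 'cV[R]_n) : R :=
  (u^T *m v) 0 0.

Definition mxinner (R : realType) (m n : nat) (A B : 'M[R]_(m, n)) : R :=
  \sum_i \sum_j A i j * B i j.

Definition optpersp_feasible (R : realType) (n : nat)
    (X : set ('cV[R]_n * 'cV[R]_n)) (x y : 'cV[R]_n) (Y : 'M[R]_n) : Prop :=
  Y \is symmetricmx /\
  psd (Y - y *m y^T) /\
  (forall i, y i 0 ^+ 2 <= Y i i * x i 0) /\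
  (forall i, 0 <= x i 0 <= 1) /\
  (forall i, 0 <= y i 0) /\
  X (x, y).

Definition optpersp_obj (R : realType) (n : nat) (a b : 'cV[R]_n)
    (Q : 'M[R]_n) (x y : 'cV[R]_n) (Y : 'M[R]_n) : R :=
  dotcv a x + dotcv b y + mxinner Q Y.

(* The index [lshift n i] of ['I_(n + n)] is position [i] (the [y] block) and
   [rshift n i] is position [i + n] (the [x] block). *)
Definition shor_feasible (R : realType) (n : nat)
    (X : set ('cV[R]_n * 'cV[R]_n)) (x y : 'cV[R]_n) (Z : 'M[R]_(n + n)) :
    Prop :=
  Z \is symmetricmx /\
  (forall i : 'I_n, Z (lshift n i) (rshift n i) = y i 0) /\
  (forall i : 'I_n, Z (rshift n i) (rshift n i) = x i 0) /\
  psd (Z - col_mx y x *m row_mx y^T x^T) /\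
  (forall i, 0 <= x i 0 <= 1) /\
  (forall i, 0 <= y i 0) /\
  X (x, y).

Definition shor_obj (R : realType) (n : nat) (a b : 'cV[R]_n)
    (Q : 'M[R]_n) (x y : 'cV[R]_n) (Z : 'M[R]_(n + n)) : R :=
  dotcv a x + dotcv b y +
  \sum_(i < n) \sum_(j < n) Q i j * Z (lshift n i) (lshift n j).

(* As [ereal_inf set0 = +oo], an infeasible problem has value [+oo]. *)
Definition optpersp_value (R : realType) (n : nat) (a b : 'cV[R]_n)
    (Q : 'M[R]_n) (X : set ('cV[R]_n * 'cV[R]_n)) : \bar R :=
  ereal_inf [set v | exists (x y : 'cV[R]_n) (Y : 'M[R]_n),
    optpersp_feasible X x y Y /\ v = (optpersp_obj a b Q x y Y)%:E].

Definition shor_value (R : realType) (n : nat) (a b : 'cV[R]_n)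
    (Q : 'M[R]_n) (X : set ('cV[R]_n * 'cV[R]_n)) : \bar R :=
  ereal_inf [set v | exists (x y : 'cV[R]_n) (Z : 'M[R]_(n + n)),
    shor_feasible X x y Z /\ v = (shor_obj a b Q x y Z)%:E].

(* Main.v *)
(* In terms of the conditional covariance S = Y - yy', a Shor matrix prescribes
   the covariance c_i = y_i (1 - x_i) between the i-th y- and x-coordinates and
   the variance x_i (1 - x_i) of the latter.  Regressing the i-th x-coordinate
   on the i-th y-coordinate with slope k_i = c_i / S_ii and adding independent
   noise realizes these prescriptions; the noise variance
   x_i (1 - x_i) - k_i^2 S_ii is nonnegative exactly because of the perspective
   constraint y_i^2 <= Y_ii x_i.  Conversely the perspective constraint is a
   2 x 2 minor of Z. *)
Require Import Defs.
From mathcomp Require Import ring lra.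

Set Implicit Arguments.
Unset Strict Implicit.

Local Open Scope classical_set_scope.
Local Open Scope ring_scope.

Lemma symmetricmx_trmxP (R : realType) (m : nat) (M : 'M[R]_m) :
  reflect (M^T = M) (M \is symmetricmx).
Proof.
apply: (iffP (is_hermitianmxP _ _ _)); rewrite expr0 scale1r map_mx_id //.
Qed.

Section PositiveSemidefinite.
Variable R : realType.

Lemma psdD (m : nat) (A B : 'M[R]_m) : psd A -> psd B -> psd (A + B).
Proof.
move=> [/symmetricmx_trmxP sA pA] [/symmetricmx_trmxP sB pB]; split.
  by apply/symmetricmx_trmxP; rewrite linearD /= sA sB.
by move=> v; rewrite mulmxDr mulmxDl mxE addr_ge0.
Qed.

Lemma psd_congr (m p : nat) (A : 'M[R]_m) (B : 'M[R]_(p, m)) :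
  psd A -> psd (B *m A *m B^T).
Proof.
move=> [/symmetricmx_trmxP sA pA]; split.
  by apply/symmetricmx_trmxP; rewrite !trmx_mul trmxK sA mulmxA.
by move=> v; have := pA (B^T *m v); rewrite trmx_mul trmxK !mulmxA.
Qed.

Lemma psd_diag_mx (m : nat) (d : 'rV[R]_m) :
  (forall j, 0 <= d 0 j) -> psd (diag_mx d).
Proof.
move=> d_ge0; split; first by apply/symmetricmx_trmxP; rewrite tr_diag_mx.
move=> v; rewrite mul_mx_diag mxE sumr_ge0 // => j _; rewrite !mxE.
by rewrite mulrAC -expr2 mulr_ge0 ?sqr_ge0.
Qed.

Lemma psd_outer (m : nat) (u : 'cV[R]_m) : psd (u *m u^T).
Proof.
have psd1 : psd (1%:M : 'M[R]_1).
  by rewrite -diag_const_mx; apply: psd_diag_mx => j; rewrite mxE.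
by have := psd_congr u psd1; rewrite mulmx1.
Qed.

(** Evaluate the quadratic form at [s e_i + t e_j]. The case [i = j] is allowed and yields the sign
    of the diagonal entries. *)
Lemma psd_quad2_ge0 (m : nat) (M : 'M[R]_m) (i j : 'I_m) (s t : R) :
  psd M -> 0 <= s ^+ 2 * M i i + 2 * s * t * M i j + t ^+ 2 * M j j.
Proof.
move=> [/symmetricmx_trmxP sM pM].
pose d k : 'cV[R]_m := delta_mx k 0.
have dE k l : ((d k)^T *m M *m d l) 0 0 = M k l.
  by rewrite trmx_delta -rowE -colE !mxE.
have addE (A B : 'M[R]_1) : (A + B) 0 0 = A 0 0 + B 0 0 by rewrite mxE.
have scaleE (c : R) (A : 'M[R]_1) : (c *: A) 0 0 = c * A 0 0 by rewrite mxE.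
have Mji : M j i = M i j by rewrite -[in LHS]sM mxE.
have := pM (s *: d i + t *: d j).
rewrite !(linearD, linearZ) /= !(mulmxDl, mulmxDr).
rewrite -!(scalemxAl, scalemxAr).
by rewrite !(addE, scaleE, dE) Mji; lra.
Qed.

Lemma psd_diag_ge0 (m : nat) (M : 'M[R]_m) (i : 'I_m) : psd M -> 0 <= M i i.
Proof. by move=> /(psd_quad2_ge0 i i 1 0); lra. Qed.

Lemma psd_minor2 (m : nat) (M : 'M[R]_m) (i j : 'I_m) :
  psd M -> M i j ^+ 2 <= M i i * M j j.
Proof.
move=> pM; have Mi := psd_diag_ge0 i pM; have Mj := psd_diag_ge0 j pM.
have [Mj0|Mj_neq0] := eqVneq (M j j) 0.
  (* With [M j j = 0] this choice gives [- M i j ^+ 2 * (M i i + 2) >= 0], which forces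
     [M i j = 0]. *)
  have := psd_quad2_ge0 i j (- M i j) (M i i + 1) pM.
  rewrite Mj0; nra.
have Mj_gt0 : 0 < M j j by rewrite lt0r Mj_neq0.
rewrite -(ler_pM2l Mj_gt0).
(* Here the form equals [M j j * (M i i * M j j - M i j ^+ 2)]. *)
by have := psd_quad2_ge0 i j (M j j) (- M i j) pM; lra.
Qed.

End PositiveSemidefinite.

Section Equivalence.
Variables (R : realType) (n : nat) (X : set ('cV[R]_n * 'cV[R]_n)).

Lemma shor_ulsubmx_feasible (x y : 'cV[R]_n) (Z : 'M[R]_(n + n)) :
  shor_feasible X x y Z -> optpersp_feasible X x y (ulsubmx Z).
Proof.
move=> [/symmetricmx_trmxP sZ [Zy [Zx [pC [x01 [y_ge0 Xxy]]]]]].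
(* The perspective constraint is the minor of [Z] itself on rows [i] and [i + n], so the outer
   product is added back first. *)
have pZ : psd Z.
  rewrite -(subrK (col_mx y x *m row_mx y^T x^T) Z); apply: psdD => //.
  by rewrite -tr_col_mx; apply: psd_outer.
split; first by apply/symmetricmx_trmxP; rewrite trmx_ulsub sZ.
split.
  (* Congruence by [[I 0]] cuts out the upper left block. *)
  have := psd_congr (row_mx 1%:M 0) pC.
  rewrite -{1}(submxK Z) mul_col_row opp_block_mx add_block_mx.
  rewrite mul_row_block tr_row_mx mul_row_col !mul0mx !mul1mx !addr0.
  by rewrite trmx1 trmx0 mulmx1 mulmx0 addr0.
split=> // i; rewrite !mxE -Zy -Zx; exact: psd_minor2.
Qed.

(* At s = 0 the slope is the junk value 0, which is the right one: the
   perspective constraint then forces the covariance to vanish. *)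
Lemma noise_variance_ge0 (s yi Yi xi : R) :
  0 <= s -> 0 <= xi <= 1 -> s = Yi - yi ^+ 2 -> yi ^+ 2 <= Yi * xi ->
  yi * (1 - xi) / s * s = yi * (1 - xi) /\
  0 <= xi * (1 - xi) - (yi * (1 - xi) / s) ^+ 2 * s.
Proof.
move=> s_ge0 /andP[x0 x1] sE yY.
(* Subtract [yi ^+ 2 * xi] from both sides of the perspective constraint. *)
have le_var : yi ^+ 2 * (1 - xi) <= s * xi by rewrite sE; lra.
have [s0|s_neq0] := eqVneq s 0.
  rewrite s0 invr0 !mulr0; split; last by nra.
  apply/esym/eqP; rewrite -sqrf_eq0 exprMn; apply/eqP; nra.
have s_gt0 : 0 < s by rewrite lt0r s_neq0.
split; first by rewrite divfK.
have -> : xi * (1 - xi) - (yi * (1 - xi) / s) ^+ 2 * s =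
   (1 - xi) * (s * xi - yi ^+ 2 * (1 - xi)) / s by field.
by rewrite divr_ge0 // mulr_ge0 // subr_ge0.
Qed.

(** Keeping [Y] as the upper left block makes the objectives agree whatever [a], [b] and [Q] are. *)
Lemma optpersp_lift (x y : 'cV[R]_n) (Y : 'M[R]_n) :
  optpersp_feasible X x y Y ->
  exists2 Z : 'M[R]_(n + n), shor_feasible X x y Z & ulsubmx Z = Y.
Proof.
move=> [sY [pS [persp [x01 [y_ge0 Xxy]]]]].
set S := Y - y *m y^T in pS.
have SE i : S i i = Y i i - y i 0 ^+ 2.
  by rewrite !mxE big_ord1 !mxE expr2.
have SK : S + y *m y^T = Y by rewrite subrK.
(* Only [SE] and [SK] are needed from here on; a transparent [S] would be expanded by [mxE]. *)
clearbody S.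
have noise i := noise_variance_ge0 (psd_diag_ge0 i pS) (x01 i) (SE i) (persp i).
pose k : 'rV[R]_n := \row_i (y i 0 * (1 - x i 0) / S i i).
pose e : 'rV[R]_n := \row_i (x i 0 * (1 - x i 0) - k 0 i ^+ 2 * S i i).
(* Covariance of [(u, diag(k) u + w)], with [u] of covariance [S] and [w] independent noise of
   covariance [diag(e)]. As a sum of two congruences it is visibly psd. *)
pose C := col_mx 1%:M (diag_mx k) *m S *m (col_mx 1%:M (diag_mx k))^T
  + col_mx 0 1%:M *m diag_mx e *m (col_mx 0 1%:M)^T : 'M[R]_(n + n).
have pC : psd C.
  apply: psdD; apply: psd_congr => //; apply: psd_diag_mx => j.
  by rewrite !mxE; have [] := noise j.
have CE : C = block_mx S (S *m diag_mx k) (diag_mx k *m S)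
    (diag_mx k *m S *m diag_mx k + diag_mx e).
  rewrite /C !tr_col_mx mul_col_mx mul_col_row mul_col_mx mul_col_row.
  rewrite !trmx1 trmx0 tr_diag_mx.
  rewrite !mul1mx !mul0mx !mulmx0 !mulmx1 add_block_mx.
  by rewrite !addr0.
pose Z := C + col_mx y x *m row_mx y^T x^T.
have ZE : Z = block_mx Y (S *m diag_mx k + y *m x^T)
    (diag_mx k *m S + x *m y^T)
    (diag_mx k *m S *m diag_mx k + diag_mx e + x *m x^T).
  by rewrite /Z CE mul_col_row add_block_mx SK.
exists Z; last by rewrite ZE block_mxKul.
have pZ : psd Z by apply: psdD => //; rewrite -tr_col_mx; apply: psd_outer.
split; first by case: pZ.
split=> [i|].
  (* The entry is [S i i * k_i + y_i x_i], and [noise] gives [S i i * k_i = y_i (1 - x_i)]. *)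
  rewrite ZE block_mxEur mxE mul_mx_diag !mxE big_ord1 !mxE.
  have [+ _] := noise i; lra.
split=> [i|]; last by rewrite /Z addrK.
(* By the choice of [e] the terms in [k] cancel, leaving [x_i (1 - x_i) + x_i ^+ 2]. *)
rewrite ZE block_mxEdr mxE [X in X + _]mxE mul_mx_diag mul_diag_mx !mxE.
rewrite big_ord1 !mxE eqxx mulr1n; ring.
Qed.

Lemma shor_obj_ulsubmx (a b : 'cV[R]_n) (Q : 'M[R]_n) (x y : 'cV[R]_n)
    (Z : 'M[R]_(n + n)) :
  optpersp_obj a b Q x y (ulsubmx Z) = shor_obj a b Q x y Z.
Proof.
congr (_ + _); apply: eq_bigr => i _; apply: eq_bigr => j _.
by rewrite !mxE.
Qed.

End Equivalence.

Theorem theorem1 (R : realType) (n : nat) (n_ge1 : (1 <= n)%N)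
    (a b : 'cV[R]_n) (Q : 'M[R]_n) (Q_psd : psd Q)
    (X : set ('cV[R]_n * 'cV[R]_n))
    (X_closed : closed X) (X_convex : convex_set X) :
  (forall (x y : 'cV[R]_n) (Z : 'M[R]_(n + n)),
     shor_feasible X x y Z ->
     exists (x1 y1 : 'cV[R]_n) (Y : 'M[R]_n),
       optpersp_feasible X x1 y1 Y /\
       optpersp_obj a b Q x1 y1 Y = shor_obj a b Q x y Z) /\
  (forall (x y : 'cV[R]_n) (Y : 'M[R]_n),
     optpersp_feasible X x y Y ->
     exists (x1 y1 : 'cV[R]_n) (Z : 'M[R]_(n + n)),
       shor_feasible X x1 y1 Z /\
       shor_obj a b Q x1 y1 Z = optpersp_obj a b Q x y Y) /\
  optpersp_value a b Q X = shor_value a b Q X.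
Proof.
have project x y Z : shor_feasible X x y Z ->
    exists (x1 y1 : 'cV[R]_n) (Y : 'M[R]_n), optpersp_feasible X x1 y1 Y /\
      optpersp_obj a b Q x1 y1 Y = shor_obj a b Q x y Z.
  move=> fZ; exists x, y, (ulsubmx Z).
  by split; [exact: shor_ulsubmx_feasible | exact: shor_obj_ulsubmx].
have lift x y Y : optpersp_feasible X x y Y ->
    exists (x1 y1 : 'cV[R]_n) (Z : 'M[R]_(n + n)), shor_feasible X x1 y1 Z /\
      shor_obj a b Q x1 y1 Z = optpersp_obj a b Q x y Y.
  move=> /optpersp_lift[Z fZ <-]; exists x, y, Z.
  by rewrite shor_obj_ulsubmx.
split=> //; split=> //; congr ereal_inf; apply/seteqP; split.
  move=> _ [x [y [Y [/lift[x1 [y1 [Z [fZ <-]]]] ->]]]].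
  by exists x1, y1, Z.
move=> _ [x [y [Z [/project[x1 [y1 [Y [fY <-]]]] ->]]]].
by exists x1, y1, Y.
Qed.
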